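(* Let $\mathbb{V}$ be an $n$-dimensional vector space ($n\ge 1$) over a finite field $\mathbb{F}$ with $q$ elements, with basis $\{\alpha_1,\ldots,\alpha_n\}$, and let $\Gamma(\mathbb{V})$ be its non-zero component graph with respect to this basis. If $q>2$ and $n$ is odd, then the clique number of $\Gamma(\mathbb{V})$ is $$\omega(\Gamma(\mathbb{V}))=\sum_{r=\lfloor n/2\rfloor+1}^{n}\binom{n}{r}(q-1)^r.$$
   Context: Let $\theta$ be the null vector of $\mathbb{V}$. Every $\mathbf{a}\in\mathbb{V}$ is written uniquely as $\mathbf{a}=a_1\alpha_1+\cdots+a_n\alpha_n$. The non-zero component graph $\Gamma(\mathbb{V})$ with respect to the basis $\{\alpha_1,\ldots,\alpha_n\}$ is the simple graph with vertex set $\mathbb{V}\setminus\{\theta\}$ in which two distinct vertices $\mathbf{a},\mathbf{b}$ are adjacent if and only if there is at least one $i$ such that the coefficients of $\alpha_i$ in $\mathbf{a}$ and in $\mathbf{b}$ are both non-zero. The clique number $\omega(G)$ is the maximum size of a set of pairwise adjacent vertices of $G$. *)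

(* Defs.v *)
From mathcomp Require Import all_boot all_order all_algebra all_field.

Set Implicit Arguments.
Unset Strict Implicit.
Unset Printing Implicit Defensive.

Import GRing.Theory.
Local Open Scope ring_scope.

Record sgraph := SGraph {
  vertex :> finType;
  adj : rel vertex;
  adj_sym : symmetric adj;
  adj_irrefl : irreflexive adj
}.

Definition clique (G : sgraph) (C : {set G}) : bool :=
  [forall a in C, forall b in C, (a != b) ==> adj a b].

Definition clique_number (G : sgraph) : nat :=
  \max_(C : {set G} | clique C) #|C|.

Section NonzeroComponentGraph.
Variables (F : finFieldType) (V : vectType F) (n : nat) (alpha : n.-tuple V).

(* [finvect_type V] is [V] itself, equipped with the finite type structure it
   inherits from the finiteness of F. *)
Definition nz_vector : finType := {a : finvect_type V | a != 0}.

(* When alpha is a basis, [coord alpha i a] is the coefficient a_i of the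
   unique decomposition of a; it is not meaningful if alpha is not free. *)
Definition nzc_adj : rel nz_vector := fun a b =>
  (a != b) && [exists i : 'I_n,
    (coord alpha i (val a) != 0) && (coord alpha i (val b) != 0)].

Lemma nzc_adj_sym : symmetric nzc_adj.
Proof.
by move=> a b; rewrite /nzc_adj eq_sym; congr andb; apply: eq_existsb => i;
  rewrite andbC.
Qed.

Lemma nzc_adj_irrefl : irreflexive nzc_adj.
Proof. by move=> a; rewrite /nzc_adj eqxx. Qed.

Definition nonzero_component_graph : sgraph :=
  SGraph nzc_adj_sym nzc_adj_irrefl.

End NonzeroComponentGraph.

(* Main.v *)
Require Import Defs.
From mathcomp Require Import all_boot all_order all_algebra all_field.
From mathcomp Require Import zify.

(** Send a vertex to its support, the set of basis indices with a nonzero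
    coefficient.  Two distinct vertices are adjacent exactly when their supports
    meet, and a nonempty set [S] of indices is the support of exactly
    [(q - 1) ^ #|S|] vertices ([card_supp_fibre]), so everything reduces to
    weighing families of subsets of an [n]-element set.

    Since [n] is odd, exactly one set of each complementary pair [{S, ~: S}] has
    more than [n./2] elements; call it large.  A clique cannot contain both a
    vertex with support [S] and a vertex with support [~: S], so each pair
    contributes to it the vertices over at most one of its two members, and at
    most as many as there are over the large one, since [q - 1 >= 1]
    ([clique_pair_le]).  Summing over the large sets gives the upper bound.
    Conversely, two large sets always meet because their sizes add up to more
    than [n], so the vertices with large support form a clique attaining the
    bound. *)

Set Implicit Arguments.
Unset Strict Implicit.
Unset Printing Implicit Defensive.

Lemma sum_subsets_by_card (T : finType) (k : nat) (w : nat -> nat) :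
  \sum_(S : {set T} | k < #|S|) w #|S| =
  \sum_(k.+1 <= r < #|T|.+1) 'C(#|T|, r) * w r.
Proof.
rewrite (partition_big (fun S : {set T} => inord #|S| : 'I_#|T|.+1)
          (fun r : 'I_#|T|.+1 => k < r)) => [|S kS]; last first.
  by rewrite inordK // ltnS max_card.
rewrite big_geq_mkord /=; apply: eq_bigr => r kr.
rewrite -[in RHS]card_draws -sum_nat_const; apply: eq_big => [S | S].
  rewrite inE -val_eqE /= inordK ?ltnS ?max_card //.
  by case: eqP => [->|]; rewrite ?kr ?andbF.
by case/andP=> _ /eqP <-; rewrite inordK ?ltnS ?max_card.
Qed.

Lemma large_sets_meet (T : finType) (S S' : {set T}) :
  #|T|./2 < #|S| -> #|T|./2 < #|S'| -> exists i, (i \in S) && (i \in S').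
Proof.
move=> largeS largeS'; have /card_gt0P[i] : 0 < #|S :&: S'|.
  move: (cardsUI S S') (subset_leq_card (subsetT (S :|: S'))).
  by rewrite cardsT; lia.
by rewrite inE; exists i.
Qed.

Lemma setC_large (T : finType) (S : {set T}) :
  odd #|T| -> (#|T|./2 < #|~: S|) = ~~ (#|T|./2 < #|S|).
Proof.
by move=> odd_T; move: (cardsC S) (odd_double_half #|T|); rewrite odd_T; lia.
Qed.

Section Supports.
Variables (F : finFieldType) (V : vectType F) (n : nat) (alpha : n.-tuple V).
Hypothesis alpha_basis : basis_of fullv alpha.

Local Notation G := (nonzero_component_graph alpha).

Definition coords (a : G) : {ffun 'I_n -> F} :=
  [ffun i => coord alpha i (val a : V)].

Definition supp (a : G) : {set 'I_n} := [set i | coords a i != 0%R].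

Lemma adjE (a b : G) :
  adj a b = (a != b) && [exists i, (i \in supp a) && (i \in supp b)].
Proof.
by congr (_ && _); apply: eq_existsb => i; rewrite !inE !ffunE.
Qed.

Lemma coords_inj : injective coords.
Proof.
move=> a b /ffunP eq_ab; apply: val_inj.
rewrite [LHS](coord_basis alpha_basis (memvf (val a : V))).
rewrite [RHS](coord_basis alpha_basis (memvf (val b : V))).
by apply: eq_bigr => i _; have := eq_ab i; rewrite !ffunE => ->.
Qed.

Lemma coords_onto (f : {ffun 'I_n -> F}) (i0 : 'I_n) :
  f i0 != 0%R -> exists a : G, coords a = f.
Proof.
move=> fi0; pose v : V := (\sum_i f i *: alpha`_i)%R.
have cv i : coord alpha i v = f i.
    by rewrite coord_sum_free // (basis_free alpha_basis).
have nz_v : ((v : finvect_type V) != 0)%R.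
  by apply: contraNneq fi0 => v0; rewrite -cv v0 GRing.linear0.
by exists (exist _ (v : finvect_type V) nz_v); apply/ffunP => i; rewrite ffunE.
Qed.

(** The vertices with support [S] are the choices of a nonzero coefficient at
    each index of [S]; nonemptiness excludes the null vector, which is not a
    vertex. *)
Lemma card_supp_fibre (S : {set 'I_n}) :
  S != set0 -> #|[set a | supp a == S]| = (#|F| - 1) ^ #|S|.
Proof.
case/set0Pn=> i0 Si0.
rewrite -(card_imset _ coords_inj) subn1 -(cardC1 (0%R : F)).
rewrite -(card_pffun_on (0%R : F)); apply: eq_card => f.
apply/imsetP/pffun_onP => [[a] | [/subsetP f_S f_nz]].
  rewrite inE => /eqP <- ->; split.
    by apply/subsetP => i; rewrite !inE.
  by move=> x /imageP[i]; rewrite inE => nz_i ->.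
have fE i : (f i != 0%R) = (i \in S).
  apply/idP/idP => [nz_i | Si]; first exact: f_S.
  by have := f_nz (f i) (image_f f Si).
have [a def_f] : exists a, coords a = f by apply: (@coords_onto f i0); rewrite fE.
by exists a => //; rewrite inE; apply/eqP/setP => i; rewrite inE def_f fE.
Qed.

Lemma clique_supp_disjoint (C : {set G}) (a b : G) :
  0 < n -> clique C -> a \in C -> b \in C -> supp b <> ~: supp a.
Proof.
move=> n_gt0 /forall_inP/(_ a) cl Ca Cb eq_ba.
have ba' i : (i \in supp b) = (i \notin supp a) by rewrite eq_ba inE.
have neq_ab : a != b.
  apply/eqP => eq_ab; move: (ba' (Ordinal n_gt0)).
  by rewrite eq_ab; case: (_ \in _).
have := implyP (forall_inP (cl Ca) b Cb) neq_ab.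
rewrite adjE neq_ab => /existsP[i].
by rewrite ba' andbN.
Qed.

(** One of the two fibres over a complementary pair misses the clique; when it
    is the one over the larger set, the other has at most
    [(#|F| - 1) ^ #|~: S|] elements, which is no more than
    [(#|F| - 1) ^ #|S|]. *)
Lemma clique_pair_le (C : {set G}) (S : {set 'I_n}) :
  0 < n -> clique C -> S != set0 -> #|~: S| <= #|S| ->
  #|[set a in C | supp a == S]| + #|[set a in C | supp a == ~: S]|
    <= (#|F| - 1) ^ #|S|.
Proof.
move=> n_gt0 clC S_nz leS.
have fibre_le T : #|[set a in C | supp a == T]| <= #|[set a | supp a == T]|.
  by apply/subset_leq_card/subsetP => a; rewrite !inE => /andP[].
have [S0 | [a]] := set_0Vmem [set a in C | supp a == S]; last first.
  rewrite inE => /andP[Ca /eqP supp_a].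
  have -> : [set b in C | supp b == ~: S] = set0.
    apply/setP => b; rewrite !inE; apply/negP => /andP[Cb /eqP supp_b].
    by apply: (clique_supp_disjoint n_gt0 clC Ca Cb); rewrite supp_a.
  by rewrite cards0 addn0 -card_supp_fibre.
rewrite S0 cards0 add0n.
have [SC0 | SC_nz] := eqVneq (~: S) set0.
  (* Here the other fibre is empty, as no vertex has empty support. *)
  suff -> : [set a in C | supp a == ~: S] = set0 by rewrite cards0.
  apply/setP => a; rewrite !inE SC0; apply/negP => /andP[_ /eqP supp_a].
  case/negP: (valP a); apply/eqP.
  rewrite [LHS](coord_basis alpha_basis (memvf (val a : V))).
  rewrite big1 // => i _; move/setP/(_ i): supp_a.
  by rewrite !inE ffunE => /negbFE/eqP ->; rewrite GRing.scale0r.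
apply: leq_trans (fibre_le _) _; rewrite card_supp_fibre //.
by rewrite leq_pexp2l // subn_gt0 card_finNzRing_gt1.
Qed.

Lemma card_by_supp (C : {set G}) :
  #|C| = \sum_(S : {set 'I_n}) #|[set a in C | supp a == S]|.
Proof.
rewrite -sum1_card (partition_big supp predT) //=.
by apply: eq_bigr => S _; rewrite -sum1_card; apply: eq_bigl => a; rewrite inE.
Qed.

Lemma clique_card_le (C : {set G}) :
  odd n -> clique C ->
  #|C| <= \sum_(S : {set 'I_n} | n./2 < #|S|) (#|F| - 1) ^ #|S|.
Proof.
move=> n_odd clC; pose large (S : {set 'I_n}) := n./2 < #|S|.
have largeC S : large (~: S) = ~~ large S.
  by have := @setC_large _ S; rewrite card_ord; apply.
rewrite card_by_supp (bigID large) /=.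
rewrite [X in _ + X](reindex_inj (@setC_inj _)) /=.
rewrite [X in _ + X](eq_bigl large) => [|S]; last by rewrite largeC negbK.
rewrite -big_split /=; apply: leq_sum => S largeS.
apply: clique_pair_le => //; first by case: (n) n_odd.
  by rewrite -card_gt0; apply: leq_ltn_trans largeS.
by move: (largeC S) largeS; rewrite /large => + lS; rewrite lS; lia.
Qed.

Lemma clique_large_supp : clique [set a : G | n./2 < #|supp a|].
Proof.
apply/forall_inP => a; rewrite inE => La; apply/forall_inP => b; rewrite inE => Lb.
apply/implyP => neq_ab; rewrite adjE neq_ab; apply/existsP.
by apply: large_sets_meet; rewrite card_ord.
Qed.

Lemma card_large_supp :
  #|[set a : G | n./2 < #|supp a|]| =
  \sum_(S : {set 'I_n} | n./2 < #|S|) (#|F| - 1) ^ #|S|.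
Proof.
rewrite -sum1_card (partition_big supp (fun S => n./2 < #|S|)) => [|a] /=.
  apply: eq_bigr => S largeS; rewrite -card_supp_fibre; last first.
    by rewrite -card_gt0; apply: leq_ltn_trans largeS.
  rewrite -sum1_card; apply: eq_bigl => a; rewrite !inE.
  by case: eqP => [->|]; rewrite ?largeS ?andbF.
by rewrite inE.
Qed.

End Supports.

Theorem corollary4p2 (F : finFieldType) (q : nat) (hq : #|F| = q)
    (V : vectType F) (n : nat) (hn : (1 <= n)%N)
    (alpha : n.-tuple V) (halpha : basis_of fullv alpha)
    (hq2 : (2 < q)%N) (hodd : odd n) :
  clique_number (nonzero_component_graph alpha) =
    (\sum_((n./2).+1 <= r < n.+1) 'C(n, r) * (q - 1) ^ r)%N.
Proof.
have := @sum_subsets_by_card 'I_n n./2 (fun r => (q - 1) ^ r).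
rewrite card_ord => <-; rewrite -hq.
apply/eqP; rewrite eqn_leq; apply/andP; split.
  by apply/bigmax_leqP => C; apply: clique_card_le.
rewrite -(card_large_supp halpha).
exact: bigmax_sup (clique_large_supp alpha) (leqnn _).
Qed.
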